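(* Let $E=D[x,y;\sigma,\tau,b,\rho]$ be a diskew polynomial ring such that $\rho$ is a unit in $D$, $\nu=\tau\sigma$ is an epimorphism (a surjective endomorphism of $D$) and $D$ is a $\mathbb{Q}$-algebra. The following statements are equivalent. 1. The ring $E$ is a simple ring. 2. (a) The endomorphisms $\sigma$ and $\tau$ of $D$ are automorphisms; (b) the ring $D$ is a $\sigma$-simple ring; (c) there is no element $\alpha\in D$ such that $\rho\alpha-\sigma(\alpha)=b$ and $\alpha d=\nu(d)\alpha$ for all elements $d\in D$; and (d) the elements $b_i\in D$, where $i\ge 1$, are units in $D$. (In particular, $b=b_1\in D$ is a unit.)
   Context: Diskew polynomial ring: let $D$ be a ring, $\sigma,\tau$ ring endomorphisms of $D$, and $\rho,b\in D$ such that $\sigma\tau(d)\rho=\rho\,\tau\sigma(d)$ and $\sigma\tau(d)b=bd$ for all $d\in D$. Then $E=D[x,y;\sigma,\tau,b,\rho]$ is the ring generated by $D$, $x$ and $y$ subject to the defining relations $xd=\sigma(d)x$, $yd=\tau(d)y$ for all $d\in D$, and $xy-\rho yx=b$. Products of endomorphisms are compositions. For $i\ge1$: $a_i:=\sigma^{i-1}(\rho)\cdots\sigma(\rho)\rho$ and $b_i:=\sum_{j=1}^{i-1}\sigma^j(a_{i-j})\sigma^{j-1}(b)+\sigma^{i-1}(b)$ (equivalently, $\sigma^i(h)=a_ih+b_i$ where $h=yx$ and $\sigma$ is extended to the skew polynomial ring $D[h;\tau\sigma]$ by $\sigma(h)=\rho h+b$). $D$ is $\sigma$-simple if $0$ and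 $D$ are the only ideals $I$ of $D$ with $\sigma(I)\subseteq I$. *)

(* Defs.v *)
From HB Require Import structures.
From mathcomp Require Import all_boot all_order all_algebra generic_quotient.
From mathcomp Require Import boolp classical_sets.

Set Implicit Arguments.
Unset Strict Implicit.
Unset Printing Implicit Defensive.

Import GRing.Theory.
Local Open Scope classical_set_scope.
Local Open Scope ring_scope.
Local Open Scope quotient_scope.

(* [GRing.unit] needs a unitRingType, i.e. a ring given with an inverse
   operation; the rings below carry no such data. *)
Definition is_unit (R : pzRingType) (u : R) : Prop :=
  exists v : R, v * u = 1 /\ u * v = 1.

Definition two_sided_ideal (R : pzRingType) (I : set R) : Prop :=
  [/\ I 0,
      forall u v, I u -> I v -> I (u - v) &
      forall r u, I u -> I (r * u) /\ I (u * r)].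

Definition simple_ring (R : pzRingType) : Prop :=
  (1 : R) <> 0 /\
  forall I : set R, two_sided_ideal I -> I = [set 0] \/ I = setT.

Definition sigma_simple (R : pzRingType) (sigma : R -> R) : Prop :=
  forall I : set R, two_sided_ideal I -> sigma @` I `<=` I ->
    I = [set 0] \/ I = setT.

(* The ring D[x, y; sigma, tau, b, rho], presented by generators and relations:
   noncommutative ring expressions over D, x and y, modulo the least ring
   congruence [diskew_rel] that makes [DC] a ring morphism and contains the
   three families of defining relations.  The constants [DC 0] and [DC 1] serve
   as the zero and the one of the ring. *)
Inductive diskew_expr (D : Type) : Type :=
| DC of D
| DX
| DY
| DAdd of diskew_expr D & diskew_expr D
| DOpp of diskew_expr D
| DMul of diskew_expr D & diskew_expr D.

Arguments DX {D}.
Arguments DY {D}.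

HB.instance Definition _ (D : Type) := gen_eqMixin (diskew_expr D).
HB.instance Definition _ (D : Type) := gen_choiceMixin (diskew_expr D).

Section Diskew.
Variables (D : pzRingType) (sigma tau : {rmorphism D -> D}) (b rho : D).

Inductive diskew_rel : diskew_expr D -> diskew_expr D -> Prop :=
| dr_refl e : diskew_rel e e
| dr_sym e f : diskew_rel e f -> diskew_rel f e
| dr_trans e f g : diskew_rel e f -> diskew_rel f g -> diskew_rel e g
| dr_add e e' f f' : diskew_rel e e' -> diskew_rel f f' ->
    diskew_rel (DAdd e f) (DAdd e' f')
| dr_opp e e' : diskew_rel e e' -> diskew_rel (DOpp e) (DOpp e')
| dr_mul e e' f f' : diskew_rel e e' -> diskew_rel f f' ->
    diskew_rel (DMul e f) (DMul e' f')
| dr_addA e f g : diskew_rel (DAdd e (DAdd f g)) (DAdd (DAdd e f) g)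
| dr_addC e f : diskew_rel (DAdd e f) (DAdd f e)
| dr_add0 e : diskew_rel (DAdd (DC 0) e) e
| dr_addN e : diskew_rel (DAdd (DOpp e) e) (DC 0)
| dr_mulA e f g : diskew_rel (DMul e (DMul f g)) (DMul (DMul e f) g)
| dr_mul1l e : diskew_rel (DMul (DC 1) e) e
| dr_mul1r e : diskew_rel (DMul e (DC 1)) e
| dr_mulDl e f g :
    diskew_rel (DMul (DAdd e f) g) (DAdd (DMul e g) (DMul f g))
| dr_mulDr e f g :
    diskew_rel (DMul e (DAdd f g)) (DAdd (DMul e f) (DMul e g))
| dr_CD c d : diskew_rel (DC (c + d)) (DAdd (DC c) (DC d))
| dr_CM c d : diskew_rel (DC (c * d)) (DMul (DC c) (DC d))
| dr_xC d : diskew_rel (DMul DX (DC d)) (DMul (DC (sigma d)) DX)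
| dr_yC d : diskew_rel (DMul DY (DC d)) (DMul (DC (tau d)) DY)
| dr_xy : diskew_rel
    (DAdd (DMul DX DY) (DOpp (DMul (DC rho) (DMul DY DX)))) (DC b).

Definition diskew_relb (e f : diskew_expr D) : bool := `[< diskew_rel e f >].

Lemma diskew_relb_refl : reflexive diskew_relb.
Proof. by move=> e; apply/asboolP; exact: dr_refl. Qed.

Lemma diskew_relb_sym : symmetric diskew_relb.
Proof. by move=> e f; apply/asboolP/asboolP; exact: dr_sym. Qed.

Lemma diskew_relb_trans : transitive diskew_relb.
Proof. by move=> f e g /asboolP ef /asboolP fg; apply/asboolP/(dr_trans ef). Qed.

Canonical diskew_equiv :=
  EquivRel diskew_relb diskew_relb_refl diskew_relb_sym diskew_relb_trans.

Definition diskew := {eq_quot diskew_equiv}.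

HB.instance Definition _ : EqQuotient _ diskew_equiv diskew :=
  EqQuotient.on diskew.
HB.instance Definition _ := Choice.on diskew.

Lemma diskew_piP e f : \pi_diskew e = \pi_diskew f <-> diskew_rel e f.
Proof.
split=> [/eqmodP/asboolP //|ef].
by apply/eqmodP/asboolP.
Qed.

Lemma diskew_repr e : diskew_rel (repr (\pi_diskew e)) e.
Proof. by apply/diskew_piP; rewrite reprK. Qed.

Definition diskewC (d : D) : diskew := \pi_diskew (DC d).
Definition diskewX : diskew := \pi_diskew DX.
Definition diskewY : diskew := \pi_diskew DY.

Definition diskew_add (u v : diskew) : diskew :=
  \pi_diskew (DAdd (repr u) (repr v)).
Definition diskew_opp (u : diskew) : diskew := \pi_diskew (DOpp (repr u)).
Definition diskew_mul (u v : diskew) : diskew :=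
  \pi_diskew (DMul (repr u) (repr v)).

Lemma diskew_addE e f :
  diskew_add (\pi_diskew e) (\pi_diskew f) = \pi_diskew (DAdd e f).
Proof. by apply/diskew_piP/dr_add; exact: diskew_repr. Qed.

Lemma diskew_oppE e : diskew_opp (\pi_diskew e) = \pi_diskew (DOpp e).
Proof. by apply/diskew_piP/dr_opp; exact: diskew_repr. Qed.

Lemma diskew_mulE e f :
  diskew_mul (\pi_diskew e) (\pi_diskew f) = \pi_diskew (DMul e f).
Proof. by apply/diskew_piP/dr_mul; exact: diskew_repr. Qed.

Lemma diskew_addA : associative diskew_add.
Proof.
elim/quotW=> e; elim/quotW=> f; elim/quotW=> g.
rewrite (diskew_addE f g) (diskew_addE e f) !diskew_addE.
exact/diskew_piP/dr_addA.
Qed.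

Lemma diskew_addC : commutative diskew_add.
Proof.
elim/quotW=> e; elim/quotW=> f.
by rewrite !diskew_addE; apply/diskew_piP/dr_addC.
Qed.

Lemma diskew_add0 : left_id (diskewC 0) diskew_add.
Proof. by elim/quotW=> e; rewrite diskew_addE; apply/diskew_piP/dr_add0. Qed.

Lemma diskew_addN : left_inverse (diskewC 0) diskew_opp diskew_add.
Proof.
elim/quotW=> e.
by rewrite diskew_oppE diskew_addE; apply/diskew_piP/dr_addN.
Qed.

HB.instance Definition _ := GRing.isZmodule.Build diskew
  diskew_addA diskew_addC diskew_add0 diskew_addN.

Lemma diskew_mulA : associative diskew_mul.
Proof.
elim/quotW=> e; elim/quotW=> f; elim/quotW=> g.
rewrite (diskew_mulE f g) (diskew_mulE e f) !diskew_mulE.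
exact/diskew_piP/dr_mulA.
Qed.

Lemma diskew_mul1l : left_id (diskewC 1) diskew_mul.
Proof. by elim/quotW=> e; rewrite diskew_mulE; apply/diskew_piP/dr_mul1l. Qed.

Lemma diskew_mul1r : right_id (diskewC 1) diskew_mul.
Proof. by elim/quotW=> e; rewrite diskew_mulE; apply/diskew_piP/dr_mul1r. Qed.

Lemma diskew_mulDl : left_distributive diskew_mul diskew_add.
Proof.
elim/quotW=> e; elim/quotW=> f; elim/quotW=> g.
rewrite (diskew_addE e f) (diskew_mulE e g) (diskew_mulE f g).
by rewrite diskew_addE diskew_mulE; apply/diskew_piP/dr_mulDl.
Qed.

Lemma diskew_mulDr : right_distributive diskew_mul diskew_add.
Proof.
elim/quotW=> e; elim/quotW=> f; elim/quotW=> g.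
rewrite (diskew_addE f g) (diskew_mulE e f) (diskew_mulE e g).
by rewrite diskew_addE diskew_mulE; apply/diskew_piP/dr_mulDr.
Qed.

HB.instance Definition _ := GRing.Zmodule_isPzRing.Build diskew
  diskew_mulA diskew_mul1l diskew_mul1r diskew_mulDl diskew_mulDr.

Lemma diskewC_is_nmod_morphism : nmod_morphism diskewC.
Proof.
split=> // c d.
by rewrite -[RHS]/(diskew_add _ _) diskew_addE; apply/diskew_piP/dr_CD.
Qed.

HB.instance Definition _ :=
  GRing.isNmodMorphism.Build D diskew diskewC diskewC_is_nmod_morphism.

Lemma diskewC_is_monoid_morphism : monoid_morphism diskewC.
Proof.
split=> // c d.
by rewrite -[RHS]/(diskew_mul _ _) diskew_mulE; apply/diskew_piP/dr_CM.
Qed.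

HB.instance Definition _ :=
  GRing.isMonoidMorphism.Build D diskew diskewC diskewC_is_monoid_morphism.

Lemma diskewXC d : diskewX * diskewC d = diskewC (sigma d) * diskewX.
Proof.
rewrite -[LHS]/(diskew_mul _ _) -[RHS]/(diskew_mul _ _) !diskew_mulE.
exact/diskew_piP/dr_xC.
Qed.

Lemma diskewYC d : diskewY * diskewC d = diskewC (tau d) * diskewY.
Proof.
rewrite -[LHS]/(diskew_mul _ _) -[RHS]/(diskew_mul _ _) !diskew_mulE.
exact/diskew_piP/dr_yC.
Qed.

Lemma diskewXY :
  diskewX * diskewY - diskewC rho * (diskewY * diskewX) = diskewC b.
Proof.
rewrite -[LHS]/(diskew_add (diskew_mul _ _)
  (diskew_opp (diskew_mul _ (diskew_mul _ _)))).
rewrite (diskew_mulE DX DY) (diskew_mulE DY DX) diskew_mulE.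
by rewrite diskew_oppE diskew_addE; apply/diskew_piP/dr_xy.
Qed.

Section UniversalProperty.
Variables (R : pzRingType) (f : {rmorphism D -> R}) (x y : R).

Fixpoint diskew_eval (e : diskew_expr D) : R :=
  match e with
  | DC d => f d
  | DX => x
  | DY => y
  | DAdd e1 e2 => diskew_eval e1 + diskew_eval e2
  | DOpp e1 => - diskew_eval e1
  | DMul e1 e2 => diskew_eval e1 * diskew_eval e2
  end.

Hypothesis xC : forall d, x * f d = f (sigma d) * x.
Hypothesis yC : forall d, y * f d = f (tau d) * y.
Hypothesis xy : x * y - f rho * (y * x) = f b.

Lemma diskew_eval_rel e e' :
  diskew_rel e e' -> diskew_eval e = diskew_eval e'.
Proof.
elim=> //= *; rewrite ?rmorph0 ?rmorph1 ?rmorphD ?rmorphM //;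
  try congruence.
- exact: addrA.
- exact: addrC.
- exact: add0r.
- exact: addNr.
- exact: mulrA.
- exact: mul1r.
- exact: mulr1.
- exact: mulrDl.
- exact: mulrDr.
Qed.

Lemma diskew_universal :
  exists2 g : {rmorphism diskew -> R},
    [/\ forall d, g (diskewC d) = f d, g diskewX = x & g diskewY = y] &
    forall h : {rmorphism diskew -> R},
      [/\ forall d, h (diskewC d) = f d, h diskewX = x & h diskewY = y] ->
      h =1 g.
Proof.
pose g (u : diskew) := diskew_eval (repr u).
have gE e : g (\pi_diskew e) = diskew_eval e.
  exact/diskew_eval_rel/diskew_repr.
have gD : nmod_morphism g.
  split=> [|u v]; first by rewrite -[0]/(diskewC 0) gE /= rmorph0.
  by rewrite -[u + v]/(diskew_add u v) gE.
have gM : monoid_morphism g.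
  split=> [|u v]; first by rewrite -[1]/(diskewC 1) gE /= rmorph1.
  by rewrite -[u * v]/(diskew_mul u v) gE.
pose ga := GRing.isNmodMorphism.Build diskew R g gD.
pose gm := GRing.isMonoidMorphism.Build diskew R g gM.
pose G : {rmorphism diskew -> R} := HB.pack g ga gm.
exists G; first by split=> [d||]; rewrite /= gE.
move=> h [hC hX hY].
elim/quotW=> e; rewrite [RHS]gE; elim: e => //=.
- by move=> e1 IH1 e2 IH2; rewrite -IH1 -IH2 -rmorphD -diskew_addE.
- by move=> e IH; rewrite -IH -rmorphN -diskew_oppE.
- by move=> e1 IH1 e2 IH2; rewrite -IH1 -IH2 -rmorphM -diskew_mulE.
Qed.

End UniversalProperty.

(* sigma^(i-1)(rho) ... sigma(rho) rho, in this order. *)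
Definition diskew_a (i : nat) : D :=
  \prod_(j < i) iter (i.-1 - j) sigma rho.

Definition diskew_b (i : nat) : D :=
  \sum_(1 <= j < i) iter j sigma (diskew_a (i - j)) * iter j.-1 sigma b
  + iter i.-1 sigma b.

End Diskew.

(* Main.v *)
From HB Require Import structures.
Require Import Defs.
From mathcomp Require Import all_boot all_order all_algebra generic_quotient.
From mathcomp Require Import boolp classical_sets functions.

Set Implicit Arguments.
Unset Strict Implicit.
Unset Printing Implicit Defensive.

Import GRing.Theory.
Local Open Scope ring_scope.
Local Open Scope quotient_scope.

(** Write h = y x and nu = tau sigma.  The relations give h d = nu(d) h,
x h = (rho h + b) x and, by iteration, x^n h = (a_n h + b_n) x^n and
x^(n+1) y = (a_(n+1) h + b_(n+1)) x^n.

Necessity.  D acts on sequences w : nat -> D, thought of as formal sums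
w_0 + w_1 x + w_2 x^2 + ..., and this extends to a right action of E in which
y sends the coefficient of x^(n+1) to that of x^n after multiplication by
b_(n+1); it is E / yE, completed.  If K is a set of sequences stable under this
action, the annihilator of the quotient by K is an ideal of E, so for E simple
an element that maps everything into K is zero ([seq_annihilator]).  Three
choices of K give the three conditions.
- Sequences whose first n + 1 entries lie in the two-sided ideal D b_(n+1):
  x^(n+1) maps everything into K but is not zero, so D b_(n+1) = D
  ([simple_b_unit]).
- Sequences with entries in a sigma-stable proper ideal I of D: the elements of
  I then annihilate the quotient, so they are zero ([simple_sigma_simple]).
- Sequences that are eventually zero.  Given a forbidden alpha, one may let y
  act with the coefficients - sigma^n(alpha) in place of b_n: the relations then
  hold up to finitely many entries, and h + alpha acts as zero
  ([simple_no_alpha]).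

Since b = b_1 is a unit, sigma tau is conjugation by b, so tau is injective;
sigma is too, because rho tau sigma(d) = sigma tau(d) rho.  Both are surjective
because nu is and rho is a unit.

Sufficiency.  Let I be a proper ideal of E.  Enlarge it to the set I' of the u
with u x^n in I for some n.  This is again an ideal ([saturation_ideal]); it is
proper because x^(n+1) in I forces b_(n+1) x^n in I ([saturation_proper]); and x
can be cancelled on the right modulo I'.  The main step
([evX_independent]) is that a sum of terms p_n(h) x^n lies in I' only if all
the p_n are zero.  In a relation of least length, the possible leading
coefficients p_N form a set of skew polynomials stable under left and right
multiplication by D and under the extension of sigma with
sigma(h) = rho h + b.  Such a set contains 1 if it is not zero
([stable_family1]): by sigma-simplicity it contains a monic polynomial of least
degree m, whose uniqueness makes it normal and sigma-invariant up to a unit,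
and for m > 0 its coefficient of degree m - 1, divided by m, is a forbidden
alpha.  So one may take p_N = 1.  Subtracting (a_N h + b_N) u from u h lowers
the length, so p_0 h = (a_N h + b_N) p_0; as b_N is a unit this kills p_0 from
its lowest coefficient upwards, and cancelling x contradicts the choice of N.

Finally, E is spanned by the p(h) y^n and the p(h) x^n ([evYX_full]).
Multiplying by a power of x turns a member of I into a relation of the previous
kind, and y^n x^n is a polynomial in h whose leading coefficient is a unit, so
the terms in y vanish one after the other ([proper_ideal_eq0]). *)

(** * Annihilators of quotients of right actions *)

Section Annihilators.
Variables (D : pzRingType) (sigma tau : {rmorphism D -> D}) (b rho : D).
Local Notation E := (diskew sigma tau b rho).
(* A right action of the generators on W for which the three families of
   defining relations hold only modulo the subgroup K. *)
Variables (W : zmodType) (aC : D -> W -> W) (aX aY : W -> W) (K : set W).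
Hypothesis aC_B : forall d, {morph aC d : u v / u - v}.
Hypothesis aX_B : {morph aX : u v / u - v}.
Hypothesis aY_B : {morph aY : u v / u - v}.
Hypothesis aCD : forall c d w, aC (c + d) w = aC c w + aC d w.
Hypothesis aC1 : forall w, aC 1 w = w.
Hypothesis aCM : forall c d w, aC (c * d) w = aC d (aC c w).
Hypothesis K0 : K 0.
Hypothesis KB : forall u v, K u -> K v -> K (u - v).
Hypothesis KC : forall d w, K w -> K (aC d w).
Hypothesis KX : forall w, K w -> K (aX w).
Hypothesis KY : forall w, K w -> K (aY w).
Hypothesis relXC : forall d w, K (aC d (aX w) - aX (aC (sigma d) w)).
Hypothesis relYC : forall d w, K (aC d (aY w) - aY (aC (tau d) w)).
Hypothesis relXY :
  forall w, K (aY (aX w) - aX (aY (aC rho w)) - aC b w).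

Fixpoint right_act (e : diskew_expr D) (w : W) : W :=
  match e with
  | DC d => aC d w
  | DX => aX w
  | DY => aY w
  | DAdd e1 e2 => right_act e1 w + right_act e2 w
  | DOpp e1 => - right_act e1 w
  | DMul e1 e2 => right_act e2 (right_act e1 w)
  end.

Lemma right_actB e : {morph right_act e : u v / u - v}.
Proof.
elim: e => //= [e1 IH1 e2 IH2|e1 IH1|e1 IH1 e2 IH2] u v.
- by rewrite IH1 IH2 opprD addrACA.
- by rewrite IH1 opprD.
- by rewrite IH1 IH2.
Qed.

Lemma right_act0 e : right_act e 0 = 0.
Proof. by have := right_actB e 0 0; rewrite !subrr. Qed.

Lemma right_actN e w : right_act e (- w) = - right_act e w.
Proof. by rewrite -sub0r right_actB right_act0 sub0r. Qed.

Lemma right_actD e : {morph right_act e : u v / u + v}.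
Proof. by move=> u v; rewrite -{1}[v]opprK right_actB right_actN opprK. Qed.

Lemma sub_opp w : K w -> K (- w).
Proof. by move=> Kw; rewrite -sub0r; apply: KB. Qed.

Lemma sub_add u v : K u -> K v -> K (u + v).
Proof. by move=> Ku Kv; rewrite -[v]opprK; apply: KB => //; apply: sub_opp. Qed.

Lemma sub_right_act e w : K w -> K (right_act e w).
Proof.
elim: e w => //= [e1 IH1 e2 IH2|e1 IH1|e1 IH1 e2 IH2] w Kw.
- by apply: sub_add; [exact: IH1|exact: IH2].
- by apply: sub_opp; exact: IH1.
- by apply: IH2; exact: IH1.
Qed.

(** Because every generator preserves K, relations that hold modulo K may be
used inside a longer product, so the action on W / K factors through the
ring. *)
Lemma right_act_rel e e' : diskew_rel sigma tau b rho e e' ->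
  forall w, K (right_act e w - right_act e' w).
Proof.
have zr w w' : w = w' -> K (w - w') by move->; rewrite subrr.
have C0 w : aC 0 w = 0.
  by apply: (addrI (aC 0 w)); rewrite -aCD !addr0.
elim=> /=.
- by move=> e1 w; apply: zr.
- by move=> e1 e2 _ IH w; rewrite -opprB; apply: sub_opp.
- move=> e1 e2 e3 _ IH _ IH' w.
  by have := sub_add (IH w) (IH' w); rewrite addrA subrK.
- move=> e1 e2 e3 e4 _ IH _ IH' w.
  by have := sub_add (IH w) (IH' w); rewrite addrACA -opprD.
- by move=> e1 e2 _ IH w; rewrite -opprD; apply: sub_opp.
- move=> e1 e2 e3 e4 _ IH _ IH' w.
  have := sub_add (sub_right_act e3 (IH w)) (IH' (right_act e2 w)).
  by rewrite right_actB addrA subrK.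
- by move=> e1 e2 e3 w; apply: zr; rewrite addrA.
- by move=> e1 e2 w; apply: zr; rewrite addrC.
- by move=> e1 w; apply: zr; rewrite C0 add0r.
- by move=> e1 w; apply: zr; rewrite C0 addNr.
- by move=> e1 e2 e3 w; apply: zr.
- by move=> e1 w; apply: zr; rewrite aC1.
- by move=> e1 w; apply: zr; rewrite aC1.
- by move=> e1 e2 e3 w; apply: zr; rewrite right_actD.
- by move=> e1 e2 e3 w; apply: zr.
- by move=> c d w; apply: zr; rewrite aCD.
- by move=> c d w; apply: zr; rewrite aCM.
- by [].
- by [].
- by [].
Qed.

Definition annihilator : set E :=
  fun u => forall w, K (right_act (repr u) w).

Lemma annihilator_ideal : two_sided_ideal annihilator.
Proof.
have piK e : (forall w, K (right_act (repr (\pi_E e)) w)) <->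
             (forall w, K (right_act e w)).
  have R := right_act_rel (diskew_repr sigma tau b rho e).
  split=> h w; last by have := sub_add (R w) (h w); rewrite subrK.
  by have := KB (h w) (R w); rewrite opprB addrC subrK.
split=> /=.
- rewrite -[0 : E]/(diskewC _ _ _ _ 0); apply/piK => w /=.
  by have := aCD 0 0 w; rewrite addr0 -[X in X = _]addr0 => /addrI <-.
- move=> u v hu hv; rewrite -[u - v]/(diskew_add u (diskew_opp v)).
  elim/quotW: u hu => e /piK he; elim/quotW: v hv => f /piK hf.
  by rewrite diskew_oppE diskew_addE; apply/piK => w /=; apply: KB.
- move=> r u; elim/quotW: r => r; elim/quotW: u => e /piK he.
  split.
    rewrite -[_ * _]/(diskew_mul _ _) diskew_mulE; apply/piK => w /=.
    exact: he.
  rewrite -[_ * _]/(diskew_mul _ _) diskew_mulE; apply/piK => w /=.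
  exact: sub_right_act.
Qed.

(** In a simple ring the annihilator of the nonzero module W / K is zero. *)
Lemma simple_annihilator e : simple_ring E -> (exists w, ~ K w) ->
  (forall w, K (right_act e w)) -> \pi_E e = 0.
Proof.
move=> [_ simE] [w nKw] he.
have R := right_act_rel (diskew_repr sigma tau b rho e).
have [I0|IT] := simE _ annihilator_ideal.
  suff : annihilator (\pi_E e) by rewrite I0.
  by move=> v /=; have := sub_add (R v) (he v); rewrite subrK.
have : annihilator 1 by rewrite IT.
move=> /(_ w) /= h1; case: nKw.
have := KB h1 (right_act_rel (diskew_repr sigma tau b rho (DC 1)) w).
by rewrite /= opprB addrC subrK aC1.
Qed.

End Annihilators.

(** * Iterates of ring endomorphisms and units *)

Section IteratedMorphisms.
Variables (D : pzRingType) (f : {rmorphism D -> D}).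

Lemma iter_rmorphM n : {morph iter n f : c d / c * d}.
Proof. by elim: n => // n IH c d; rewrite /= IH rmorphM. Qed.

Lemma iter_rmorphB n : {morph iter n f : c d / c - d}.
Proof. by elim: n => // n IH c d; rewrite /= IH rmorphB. Qed.

Lemma iter_rmorphD n : {morph iter n f : c d / c + d}.
Proof. by elim: n => // n IH c d; rewrite /= IH rmorphD. Qed.

Lemma iter_rmorph1 n : iter n f 1 = 1.
Proof. by elim: n => //= n ->; rewrite rmorph1. Qed.

Lemma iter_rmorph0 n : iter n f 0 = 0.
Proof. by elim: n => //= n ->; rewrite rmorph0. Qed.

Lemma iter_surj n : (forall d, exists c, f c = d) ->
  forall d, exists c, iter n f c = d.
Proof.
move=> f_surj; elim: n => [|n IH] d; first by exists d.
by have [c <-] := f_surj d; have [c' <-] := IH c; exists c'.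
Qed.

Lemma is_unit_iter n u : is_unit u -> is_unit (iter n f u).
Proof.
move=> [v [vu uv]]; exists (iter n f v).
by rewrite -!iter_rmorphM vu uv iter_rmorph1.
Qed.

End IteratedMorphisms.

Section Units.
Variable D : pzRingType.

Lemma is_unit_mulr0 (u c : D) : is_unit u -> c * u = 0 -> c = 0.
Proof. by move=> [v [_ uv]] cu; rewrite -[c]mulr1 -uv mulrA cu mul0r. Qed.

Lemma is_unit_mull0 (u c : D) : is_unit u -> u * c = 0 -> c = 0.
Proof. by move=> [v [vu _]] uc; rewrite -[c]mul1r -vu -mulrA uc mulr0. Qed.

Lemma is_unit_mulrI (u c d : D) : is_unit u -> c * u = d * u -> c = d.
Proof.
move=> uu cd; apply/subr0_eq/(is_unit_mulr0 uu).
by rewrite mulrBl cd subrr.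
Qed.

Lemma is_unit_mul (u v : D) : is_unit u -> is_unit v -> is_unit (u * v).
Proof.
move=> [u' [u'u uu']] [v' [v'v vv']]; exists (v' * u'); split.
  by rewrite mulrA -(mulrA v') u'u mulr1.
by rewrite mulrA -(mulrA u) vv' mulr1.
Qed.

Lemma is_unit1 : is_unit (1 : D).
Proof. by exists 1; rewrite mulr1. Qed.

End Units.

(** * The coefficients b_i *)

Section Coefficients.
Variables (D : pzRingType) (sigma : {rmorphism D -> D}) (b rho : D).

Lemma diskew_a0 : diskew_a sigma rho 0 = 1.
Proof. by rewrite /diskew_a big_ord0. Qed.

Lemma diskew_aS n :
  diskew_a sigma rho n.+1 = iter n sigma rho * diskew_a sigma rho n.
Proof.
rewrite /diskew_a big_ord_recl subn0; congr (_ * _).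
by apply: eq_bigr => i _ /=; rewrite /bump /= add1n subnS -subn1 subnAC subn1.
Qed.

(** The sequence b_i, continued by b_0 = 0: with this value
x^n h = (a_n h + b_n) x^n and the recursion hold from n = 0 on, whereas the sum
that defines b_i evaluates to b at i = 0. *)
Fixpoint diskew_beta n :=
  if n is k.+1 then iter k sigma rho * diskew_beta k + iter k sigma b else 0.

Lemma diskew_betaE n : diskew_beta n.+1 = diskew_b sigma b rho n.+1.
Proof.
elim: n => [|n IH].
  by rewrite /diskew_b big_geq //= mulr0.
rewrite [LHS]/= -/(diskew_beta n.+1) IH /diskew_b; congr (_ + _).
rewrite [RHS]big_nat_recr //= subSn // subnn diskew_aS diskew_a0 mulr1.
rewrite mulrDr; congr (_ + _); rewrite mulr_sumr; apply: eq_big_nat => j.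
case/andP=> j0 jn; rewrite mulrA; congr (_ * _).
rewrite [in RHS]subSn 1?ltnW // diskew_aS iter_rmorphM -iterD.
by rewrite subnKC // ltnW.
Qed.

End Coefficients.

(** * Necessity: the action on sequences *)

Section SequenceModules.
Variables (D : pzRingType) (sigma tau : {rmorphism D -> D}) (b rho : D).
Hypothesis Hrho : forall d : D, sigma (tau d) * rho = rho * tau (sigma d).
Hypothesis Hb : forall d : D, sigma (tau d) * b = b * d.
Local Notation E := (diskew sigma tau b rho).
Local Notation beta := (diskew_beta sigma b rho).

(** This is the relation y d = tau(d) y for the action on sequences.  As sigma
and tau are surjective in the application, it makes D b_(n+1) a two-sided
ideal. *)
Lemma diskew_beta_normal n d :
  beta n.+1 * iter n sigma d = iter n.+1 sigma (tau d) * beta n.+1.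
Proof.
elim: n d => [|n IH] d; first by rewrite /= mulr0 add0r Hb.
have -> : beta n.+2 = iter n.+1 sigma rho * beta n.+1 + iter n.+1 sigma b by [].
move: (beta n.+1) IH => B IH.
rewrite mulrDl mulrDr -mulrA [in X in _ * X + _]iterSr IH !mulrA.
rewrite -!iter_rmorphM -Hb [in RHS]iterSr -!iter_rmorphM Hrho.
by rewrite iter_rmorphM.
Qed.

(** The sequence w stands for the formal sum of the w_i x^i, on which E acts
from the right; [seqY] is the rule x^(i+1) y = eta_(i+1) x^i and 1 y = 0. *)
Definition seqC (d : D) (w : nat -> D) : nat -> D :=
  fun i => w i * iter i sigma d.
Definition seqX (w : nat -> D) : nat -> D :=
  fun i => if i is j.+1 then w j else 0.
Definition seqY (eta : nat -> D) (w : nat -> D) : nat -> D :=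
  fun i => w i.+1 * eta i.+1.
Definition seq_act eta := right_act seqC seqX (seqY eta).

Lemma seqC_B d : {morph seqC d : u v / u - v}.
Proof. by move=> u v; apply/funext => i; rewrite /seqC mulrBl. Qed.

Lemma seqX_B : {morph seqX : u v / u - v}.
Proof.
by move=> u v; apply/funext => -[|i] //; rewrite !fctE /= subrr.
Qed.

Lemma seqY_B eta : {morph seqY eta : u v / u - v}.
Proof. by move=> u v; apply/funext => i; rewrite /seqY mulrBl. Qed.

Lemma seqCD c d w : seqC (c + d) w = seqC c w + seqC d w.
Proof. by apply/funext => i; rewrite /seqC iter_rmorphD mulrDr. Qed.

Lemma seqC1 w : seqC 1 w = w.
Proof. by apply/funext => i; rewrite /seqC iter_rmorph1 mulr1. Qed.

Lemma seqCM c d w : seqC (c * d) w = seqC d (seqC c w).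
Proof. by apply/funext => i; rewrite /seqC iter_rmorphM mulrA. Qed.

Lemma seqXC d w : seqC d (seqX w) = seqX (seqC (sigma d) w).
Proof.
by apply/funext => -[|i]; rewrite /seqC /seqX ?mul0r // iterSr.
Qed.

Lemma seqYC_beta d w : seqC d (seqY beta w) = seqY beta (seqC (tau d) w).
Proof.
apply/funext => i.
by rewrite /seqC /seqY -mulrA diskew_beta_normal mulrA.
Qed.

Lemma seqXY_beta w :
  seqY beta (seqX w) - seqX (seqY beta (seqC rho w)) = seqC b w.
Proof.
apply/funext => -[|i]; rewrite !fctE /seqY /seqC /=.
  by rewrite mulr0 add0r subr0.
by rewrite mulrDr mulrA addrC addKr.
Qed.

(** With the coefficients b_i all relations hold exactly, so this action detects
that an element of the ring is not zero. *)
Lemma seq_beta_act0 e : \pi_E e = 0 -> forall w, seq_act beta e w = 0.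
Proof.
move=> e0 w.
have rel : diskew_rel sigma tau b rho e (DC 0) by apply/diskew_piP.
have K0 (u v : nat -> D) : u = v -> u - v = 0 by move->; rewrite subrr.
have h : seq_act beta e w - seqC 0 w = 0.
  apply: (right_act_rel (K := fun u => u = 0) seqC_B seqX_B (seqY_B beta)
    seqCD seqC1 seqCM _ _ _ _ _ _ _ _ rel w) => //.
  - by move=> u v -> ->; rewrite subrr.
  - by move=> d _ ->; apply/funext => i; rewrite /seqC mul0r.
  - by move=> _ ->; apply/funext => -[|i].
  - by move=> _ ->; apply/funext => i; rewrite /seqY mul0r.
  - by move=> d u; apply: K0; rewrite seqXC.
  - by move=> d u; apply: K0; rewrite seqYC_beta.
  - by move=> u; apply: K0; rewrite seqXY_beta.
rewrite (subr0_eq h).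
by apply/funext => i; rewrite /seqC iter_rmorph0 mulr0.
Qed.

(** The coefficients [eta] used modulo K may differ from the b_i used in the
conclusion: the annihilator modulo K is zero in the ring, and the zero element
acts as zero in every module. *)
Lemma seq_annihilator eta (K : set (nat -> D)) (e : diskew_expr D) :
    simple_ring E ->
    (forall u v, K u -> K v -> K (u - v)) ->
    (forall d w, K w -> K (seqC d w)) ->
    (forall w, K w -> K (seqX w)) ->
    (forall w, K w -> K (seqY eta w)) ->
    (forall d w, K (seqC d (seqY eta w) - seqY eta (seqC (tau d) w))) ->
    (forall w,
       K (seqY eta (seqX w) - seqX (seqY eta (seqC rho w)) - seqC b w)) ->
    (exists w, ~ K w) ->
    (forall w, K (seq_act eta e w)) ->
  forall w, seq_act beta e w = 0.
Proof.
move=> simE KB KC KX KY relYC relXY nK he.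
have K0 : K 0 by have := KB _ _ (he 0) (he 0); rewrite subrr.
apply: seq_beta_act0.
apply: (simple_annihilator (K := K) seqC_B seqX_B (seqY_B eta) seqCD seqC1
  seqCM K0 KB KC KX KY _ relYC relXY simE nK he).
by move=> d w; rewrite seqXC subrr.
Qed.

Definition seq1 : nat -> D := fun i => if i is 0%N then 1 else 0.

Lemma simple_nontrivial : simple_ring E -> (1 : D) <> 0.
Proof.
move=> [nz _] d0; apply: nz.
by rewrite -[LHS]/(diskewC sigma tau b rho 1) d0.
Qed.

Lemma diskew_nontrivial : (1 : D) <> 0 -> (1 : E) <> 0.
Proof.
move=> nz E0; apply: nz.
have := seq_beta_act0 (e := DC 1) E0 seq1.
by move/(congr1 (fun w => w 0%N)); rewrite /seq_act /= /seqC /= mulr1.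
Qed.

Definition dpowX n : diskew_expr D := iter n (DMul DX) (DC 1).

Lemma seq_act_powX eta n w i :
  seq_act eta (dpowX n) w i = if (n <= i)%N then w (i - n)%N else 0.
Proof.
elim: n w i => [|n IH] w i; first by rewrite /= seqC1 subn0.
transitivity (seq_act eta (dpowX n) (seqX w) i); first by [].
rewrite IH.
case: (ltngtP n i) => [ni|//|->]; last by rewrite subnn.
by case: i ni => // i ni; rewrite subSn // subSS.
Qed.

Hypothesis simE : simple_ring E.
Hypothesis sigma_surj : forall d, exists c, sigma c = d.
Hypothesis tau_surj : forall d, exists c, tau c = d.

(** The sequences whose first n + 1 entries lie in D b_(n+1) are stable under y,
which multiplies the first unconstrained entry by b_(n+1).  Everything is mapped
into this set by x^(n+1), which sends 1 to x^(n+1). *)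
Lemma simple_b_unit n : is_unit (beta n.+1).
Proof.
have [[c cb]|nI] := pselect (exists c, 1 = c * beta n.+1).
  have [s sc] := iter_surj n.+1 sigma_surj c; have [r rs] := tau_surj s.
  have cbr : 1 = beta n.+1 * iter n sigma r.
    by rewrite diskew_beta_normal rs sc.
  exists c; split=> //; suff -> : c = iter n sigma r by [].
  by rewrite -[RHS]mul1r cb -mulrA -cbr mulr1.
pose I (d : D) := exists c, d = c * beta n.+1.
have IB c d : I c -> I d -> I (c - d).
  by move=> [c' ->] [d' ->]; exists (c' - d'); rewrite mulrBl.
have IM c r : I c -> I (c * r).
  move=> [c' ->]; have [s sr] := iter_surj n sigma_surj r.
  exists (c' * iter n.+1 sigma (tau s)).
  by rewrite -!mulrA -diskew_beta_normal sr.
have I0 : I 0 by exists 0; rewrite mul0r.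
case: (simple_nontrivial simE).
have := @seq_annihilator beta (fun w => forall i, (i <= n)%N -> I (w i))
  (dpowX n.+1) simE.
move=> /(_ _ _ _ _ _ _ _ _ seq1) H.
have {H} : seq_act beta (dpowX n.+1) seq1 = 0.
  apply: H.
  - by move=> u v hu hv i ni; apply: IB; [exact: hu|exact: hv].
  - by move=> d w hw i ni; apply: IM; exact: hw.
  - by move=> w hw [|i] ni //; apply: hw; exact: ltnW.
  - move=> w hw i; rewrite leq_eqVlt => /predU1P[->|ni].
      by exists (w n.+1).
    by apply: IM; exact: hw.
  - by move=> d w i _; rewrite seqYC_beta subrr.
  - by move=> w i _; rewrite seqXY_beta subrr.
  - exists seq1 => /(_ 0%N isT) [c cb]; apply: nI; by exists c.
  - by move=> w i ni; rewrite seq_act_powX ltnNge ni.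
move/(congr1 (fun w => w n.+1)).
by rewrite seq_act_powX leqnn subnn.
Qed.

Lemma simple_sigma_simple : sigma_simple sigma.
Proof.
move=> I [I0 IB IM] sI.
have [I1|nI1] := pselect (I 1).
  right; apply/seteqP; split=> // d _.
  by have [] := IM d 1 I1; rewrite mulr1.
left; apply/seteqP; split=> [d Id|d ->] //=.
have IM' c r : I c -> I (c * r) by move=> Ic; have [] := IM r c Ic.
have := @seq_annihilator beta (fun w => forall i, I (w i)) (DC d) simE.
move=> /(_ _ _ _ _ _ _ _ _ seq1) H.
have {H} : seq_act beta (DC d) seq1 = 0.
  apply: H.
  - by move=> u v hu hv i; apply: IB.
  - by move=> e w hw i; apply: IM'; exact: hw.
  - move=> w hw [|i]; [exact: I0|exact: hw].
  - by move=> w hw i; apply: IM'; exact: hw.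
  - by move=> e w i; rewrite seqYC_beta subrr.
  - by move=> w i; rewrite seqXY_beta subrr.
  - by exists seq1 => /(_ 0%N).
  - move=> w i; rewrite /seq_act /= /seqC.
    have Ii : I (iter i sigma d).
      by elim: i => //= i IH; apply: sI; exists (iter i sigma d).
    by have [] := IM (w i) _ Ii.
move/(congr1 (fun w => w 0%N)).
by rewrite /seq_act /= /seqC /= mul1r.
Qed.

(** The two conditions on alpha say that the coefficients - sigma^i(alpha)
satisfy the same recursion and normality as the b_i at every i > 0, hence define
an action modulo eventually zero sequences.  There y x + alpha acts as zero, so
it is zero in a simple ring.  Applied to 1 in the exact module it gives alpha,
so alpha = 0 and then b = 0, which is not a unit. *)
Lemma simple_no_alpha :
  ~ exists alpha, rho * alpha - sigma alpha = b /\
      forall d, alpha * d = tau (sigma d) * alpha.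
Proof.
move=> [a [ab an]]; have nz := simple_nontrivial simE.
have := @seq_annihilator (fun i => - iter i sigma a)
  (fun w => exists N, forall i, (N <= i)%N -> w i = 0)
  (DAdd (DMul DY DX) (DC a)) simE.
move=> /(_ _ _ _ _ _ _ _ _ seq1) H.
have {H} : seq_act beta (DAdd (DMul DY DX) (DC a)) seq1 = 0.
  apply: H.
  - move=> u v [N hu] [M hv]; exists (maxn N M) => i.
    by rewrite geq_max => /andP[Ni Mi]; rewrite !fctE hu // hv // subrr.
  - by move=> d w [N hw]; exists N => i Ni; rewrite /seqC hw // mul0r.
  - by move=> w [N hw]; exists N.+1 => -[|i] //; exact: hw.
  - move=> w [N hw]; exists N => i Ni.
    by rewrite /seqY hw ?mul0r // ltnW.
  - move=> d w; exists 0%N => i _; rewrite !fctE /seqC /seqY.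
    have [s <-] := sigma_surj d.
    rewrite -!mulrA -mulrBr -iterSr mulNr mulrN opprK.
    by rewrite -!iter_rmorphM an addNr mulr0.
  - move=> w; exists 1%N => -[|i] // _.
    rewrite !fctE /seqC /seqY /seqX -mulrA -!mulrBr mulrN opprK.
    rewrite -iter_rmorphM -ab iter_rmorphB -iterSr addrC opprB addrACA.
    by rewrite subrr addNr addr0 mulr0.
  - by exists (fun=> 1) => -[N /(_ _ (leqnn N))].
  - move=> w; exists 1%N => -[|i] // _.
    by rewrite /seq_act /= !fctE /seqC /seqY /= -mulrDr addNr mulr0.
move/(congr1 (fun w => w 0%N)).
rewrite /seq_act /= !fctE /seqC /= mul1r add0r => a0.
have [u [ub _]] := simple_b_unit 0.
apply: nz; rewrite -ub /= mulr0 add0r -ab a0 mulr0 rmorph0 subrr.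
by rewrite mulr0.
Qed.

End SequenceModules.

(** * The skew polynomial ring D[h; tau sigma] *)

Section SkewPolynomials.
Variables (D : nzRingType) (sigma tau : {rmorphism D -> D}) (b rho : D).
Local Notation nu := (tau \o sigma).

(** A polynomial p over D stands for the skew polynomial with the same left
coefficients.  Products in D[h; nu] enter only through [twist p d] = p d,
[hmul p] = h p and [p * 'X] = p h, so that ring is not built. *)
Definition twist (p : {poly D}) (d : D) : {poly D} :=
  \poly_(k < size p) (p`_k * iter k nu d).

Lemma coef_twist p d k : (twist p d)`_k = p`_k * iter k nu d.
Proof.
rewrite coef_poly; case: ltnP => // /leq_sizeP/(_ k (leqnn k)) ->.
by rewrite mul0r.
Qed.

Lemma size_twist p d : (size (twist p d) <= size p)%N.
Proof. exact: size_poly. Qed.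

Definition hmul (p : {poly D}) : {poly D} := map_poly nu p * 'X.

Lemma coef_hmul p k : (hmul p)`_k = if k is j.+1 then nu p`_j else 0.
Proof. by rewrite coefMX; case: k => //= k; rewrite coef_map. Qed.

(** (rho h + b)^k, the image of h^k under the extension of sigma. *)
Fixpoint sigma_pow k : {poly D} :=
  if k is j.+1 then rho *: hmul (sigma_pow j) + b *: sigma_pow j else 1.

Definition sigma_ext (p : {poly D}) : {poly D} :=
  \sum_(k < size p) sigma p`_k *: sigma_pow k.

Lemma sigma_extE n (p : {poly D}) : (size p <= n)%N ->
  sigma_ext p = \sum_(k < n) sigma p`_k *: sigma_pow k.
Proof.
move=> pn; rewrite /sigma_ext.
rewrite (big_ord_widen _ (fun k => sigma p`_k *: sigma_pow k) pn).
rewrite big_mkcond; apply: eq_bigr => i _; case: ltnP => // /leq_sizeP.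
by move=> /(_ i (leqnn i)) ->; rewrite rmorph0 scale0r.
Qed.

(** (rho h)^k = [rho_pow k] h^k. *)
Fixpoint rho_pow k : D := if k is j.+1 then rho * nu (rho_pow j) else 1.

Lemma sigma_pow_large k j : (k < j)%N -> (sigma_pow k)`_j = 0.
Proof.
elim: k j => [|k IH] [|j] //=; first by rewrite coef1.
rewrite ltnS => kj; rewrite coefD !coefZ coef_hmul !IH ?(leqW kj) //=.
by rewrite !rmorph0 !mulr0 addr0.
Qed.

Lemma sigma_pow_lead k : (sigma_pow k)`_k = rho_pow k.
Proof.
elim: k => [|k IH] /=; first by rewrite coef1.
by rewrite coefD !coefZ coef_hmul IH sigma_pow_large // mulr0 addr0.
Qed.

Hypothesis b_rho : b * rho = rho * nu b.

(** The hypothesis says that b commutes with rho h, so the binomial theorem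
applies to (rho h + b)^(k+1). *)
Lemma sigma_pow_sublead k : (sigma_pow k.+1)`_k = b * rho_pow k *+ k.+1.
Proof.
elim: k => [|k IH].
  by rewrite /= coefD !coefZ coef_hmul mulr0 add0r coef1.
rewrite [sigma_pow k.+2]/= coefD !coefZ coef_hmul -/(sigma_pow k.+1) IH.
rewrite sigma_pow_lead [RHS]mulrSr; congr (_ + _).
rewrite /= !rmorphMn !rmorphM mulrnAr mulrA.
by rewrite b_rho mulrA.
Qed.

Lemma rho_pow_unit k : is_unit rho -> is_unit (rho_pow k).
Proof.
move=> rho_u; elim: k => [|k IH] /=; first exact: is_unit1.
apply: is_unit_mul => //.
exact: (is_unit_iter tau 1 (is_unit_iter sigma 1 IH)).
Qed.

End SkewPolynomials.

(** * Stable sets of skew polynomials *)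

Section StableFamilies.
Variables (D : algType rat) (sigma tau : {rmorphism D -> D}) (b rho : D).
Local Notation nu := (tau \o sigma).
Local Notation sigma_ext := (sigma_ext sigma tau b rho).
Local Notation twist := (twist sigma tau).
Hypothesis b_rho : b * rho = rho * nu b.
Hypothesis rho_u : is_unit rho.
Hypothesis nu_surj : forall d, exists c, nu c = d.
Hypothesis simD : sigma_simple sigma.
Hypothesis no_alpha : ~ exists alpha, rho * alpha - sigma alpha = b /\
      forall d, alpha * d = nu d * alpha.

(** The only place where division by integers in D enters. *)
Lemma scaled_alpha m c :
    rho * c - sigma c = b *+ m.+1 -> (forall d, c * d = nu d * c) ->
  exists alpha, rho * alpha - sigma alpha = b /\
      forall d, alpha * d = nu d * alpha.
Proof.
move=> cb cn; pose q : rat := m.+1%:R^-1.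
have qK (d : D) : q *: (d *+ m.+1) = d.
  by rewrite -scaler_nat scalerA mulVf ?scale1r // Num.Theory.pnatr_eq0.
have Kq (d : D) : (q *: d) *+ m.+1 = d by rewrite scalerMnr qK.
exists (q *: c); split.
  rewrite -[LHS]qK mulrnBl -mulrnAr Kq.
  by rewrite -rmorphMn Kq cb qK.
by move=> d; rewrite -scalerAl cn scalerAr.
Qed.

(** A nonzero J contains a polynomial s of least degree m; the coefficients of
h^m of such polynomials form a sigma-stable ideal, so s may be taken monic.
Then s d - nu^m(d) s and sigma(s) - rho_m s, with rho_m h^m = (rho h)^m, lie in
J and have lower degree, hence are zero.  If m = k + 1, their coefficients of
h^k say that the coefficient c of h^k in s satisfies c e = nu(e) c and
rho c - sigma(c) = (k + 1) b. *)
Lemma stable_family1 (J : {poly D} -> Prop) (p : {poly D}) :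
    (forall q r, J q -> J r -> J (q - r)) ->
    (forall d q, J q -> J (d *: q)) ->
    (forall d q, J q -> J (twist q d)) ->
    (forall q, J q -> J (sigma_ext q)) ->
  J p -> p != 0 -> J 1.
Proof.
move=> JB JZ JT JS Jp nzp.
have [m [q [Jq nzq sq]] min] : exists2 m,
    exists q, [/\ J q, q != 0 & size q = m.+1] &
    forall q, J q -> (size q <= m)%N -> q = 0.
  have exP : exists n, `[< exists q, [/\ J q, q != 0 & size q = n.+1] >].
    exists (size p).-1; apply/asboolP; exists p; split=> //.
    by rewrite prednK // size_poly_gt0.
  case: (ex_minnP exP) => m /asboolP hm min; exists m => // q Jq.
  rewrite leqNgt; apply: contraNeq => nzq.
  have sq : size q = (size q).-1.+1 by rewrite prednK // size_poly_gt0.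
  by rewrite sq ltnS; apply: min; apply/asboolP; exists q.
pose I : set D := fun c => exists q, [/\ J q, (size q <= m.+1)%N & q`_m = c].
have IR c r : I c -> I (c * r).
  move=> [s [Js ss <-]]; have [t <-] := iter_surj m nu_surj r.
  exists (twist s t); split; [exact: JT| |exact: coef_twist].
  exact: leq_trans (size_twist _ _ _ _) ss.
have sizeS (s : {poly D}) : (size s <= m.+1)%N ->
    (size (sigma_ext s) <= m.+1)%N /\
    (sigma_ext s)`_m = sigma s`_m * rho_pow sigma tau rho m.
  move=> ss; rewrite (sigma_extE _ _ _ _ ss); split.
    apply: (leq_trans (size_sum _ _ _)); apply/bigmax_leqP => i _.
    apply: (leq_trans (size_scale_leq _ _)); apply: (leq_trans _ (ltn_ord i)).
    by apply/leq_sizeP => j ij; rewrite sigma_pow_large.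
  rewrite big_ord_recr /= coefD coefZ sigma_pow_lead coef_sum big1 ?add0r //.
  by move=> i _; rewrite coefZ sigma_pow_large ?mulr0.
have [v [vr rv]] := rho_pow_unit sigma tau m rho_u.
have I1 : I 1.
  have [] := simD (I := I).
  - split.
    + exists 0; split; rewrite ?size_poly0 ?coef0 //.
      by rewrite -(subrr p); exact: JB.
    + move=> c d [s [Js ss <-]] [t [Jt st <-]]; exists (s - t).
      split; [exact: JB| |by rewrite coefB].
      by apply: (leq_trans (size_polyD _ _)); rewrite geq_max ss size_polyN.
    + move=> r c Ic; split; last exact: IR.
      case: Ic => s [Js ss <-]; exists (r *: s).
      split; [exact: JZ| |by rewrite coefZ].
      exact: leq_trans (size_scale_leq _ _) ss.
  - move=> _ [_ [s [Js ss <-]] <-].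
    have [sS cS] := sizeS s ss.
    have := IR (sigma s`_m * rho_pow sigma tau rho m) v.
    rewrite -mulrA rv mulr1; apply; exists (sigma_ext s).
    by split; [exact: JS| |].
  - move=> I0; have : I (lead_coef q).
      by exists q; split=> //; rewrite ?sq // lead_coefE sq.
    by rewrite I0 => /= /eqP; rewrite lead_coef_eq0 (negPf nzq).
  - by move->.
case: I1 => s [Js ss s1].
case: m => [|k] in min s1 ss sizeS v vr rv {I IR q Jq nzq sq} * => //.
  suff -> : 1 = s by [].
  by apply/polyP => -[|j]; rewrite coef1 // nth_default // (leq_trans ss).
have drop (t : {poly D}) : J t -> (size t <= k.+2)%N -> t`_k.+1 = 0 -> t = 0.
  move=> Jt st t0; apply: min => //; apply/leq_sizeP => j.
  rewrite leq_eqVlt => /predU1P[<- //|kj].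
  by rewrite nth_default // (leq_trans st).
have sB (t u : {poly D}) : (size t <= k.+2)%N -> (size u <= k.+2)%N ->
    (size (t - u)%R <= k.+2)%N.
  move=> st su; apply: (leq_trans (size_polyD _ _)).
  by rewrite geq_max st size_polyN.
(* Every e has the form nu^k(d), and s d = nu^(k+1)(d) s. *)
have sn e : s`_k * e = nu e * s`_k.
  have [d <-] := iter_surj k nu_surj e.
  have : twist s d - iter k.+1 nu d *: s = 0.
    apply: drop.
    - by apply: JB; [exact: JT|exact: JZ].
    - apply: sB; first exact: leq_trans (size_twist _ _ _ _) ss.
      exact: leq_trans (size_scale_leq _ _) ss.
    - by rewrite coefB coefZ coef_twist s1 mul1r mulr1 subrr.
  move/(congr1 (fun t : {poly D} => t`_k)).
  by rewrite coefB coefZ coef_twist coef0 => /subr0_eq.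
(* Comparing the coefficients of h^k in sigma(s) = rho_(k+1) s. *)
case: no_alpha; apply: (@scaled_alpha k (s`_k)) => //.
have [sS cS] := sizeS s ss.
have : sigma_ext s - rho_pow sigma tau rho k.+1 *: s = 0.
  apply: drop.
  - by apply: JB; [exact: JS|exact: JZ].
  - by apply: sB => //; exact: leq_trans (size_scale_leq _ _) ss.
  - by rewrite coefB coefZ cS s1 rmorph1 mul1r mulr1 subrr.
move/(congr1 (fun t : {poly D} => t`_k)).
rewrite coefB coefZ coef0 (sigma_extE _ _ _ _ ss) !big_ord_recr /= !coefD.
rewrite coef_sum big1 ?add0r => [|i _]; last first.
  by rewrite coefZ sigma_pow_large ?mulr0.
rewrite !coefZ sigma_pow_lead sigma_pow_sublead // s1 rmorph1 mul1r.
move/subr0_eq => e; apply/subr0_eq.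
apply: (is_unit_mulr0 (rho_pow_unit sigma tau k rho_u)).
rewrite !mulrBl -mulrA sn mulrA -e mulrnAl.
by rewrite [X in X - _ - _]addrC addrK subrr.
Qed.

End StableFamilies.

(** * Polynomials in h = y x inside the diskew polynomial ring *)

Section Evaluation.
Variables (D : nzRingType) (sigma tau : {rmorphism D -> D}) (b rho : D).
Local Notation nu := (tau \o sigma).
Local Notation E := (diskew sigma tau b rho).
Local Notation C := (diskewC sigma tau b rho).
Local Notation X := (diskewX sigma tau b rho).
Local Notation Y := (diskewY sigma tau b rho).
Local Notation twist := (twist sigma tau).
Local Notation hmul := (hmul sigma tau).
Local Notation sigma_pow := (sigma_pow sigma tau b rho).
Local Notation sigma_ext := (sigma_ext sigma tau b rho).
Local Notation "'a_ n" := (diskew_a sigma rho n)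
  (at level 8, n at level 2, format "''a_' n").
Local Notation beta := (diskew_beta sigma b rho).

Lemma diskew_ind (P : E -> Prop) :
    (forall d, P (C d)) -> P X -> P Y ->
    (forall u v, P u -> P v -> P (u + v)) ->
    (forall u, P u -> P (- u)) ->
    (forall u v, P u -> P v -> P (u * v)) ->
  forall u, P u.
Proof.
move=> PC PX PY PD PN PM; elim/quotW; elim=> //=.
- move=> e IHe f IHf.
  by rewrite -diskew_addE; exact: PD.
- by move=> e IHe; rewrite -diskew_oppE; exact: PN.
- by move=> e IHe f IHf; rewrite -diskew_mulE; exact: PM.
Qed.

Definition diskewH : E := Y * X.
Local Notation h := diskewH.

Lemma diskewHC d : h * C d = C (nu d) * h.
Proof. by rewrite /h -mulrA diskewXC mulrA diskewYC -mulrA. Qed.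

Lemma diskewHnC n d : h ^+ n * C d = C (iter n nu d) * h ^+ n.
Proof.
elim: n => [|n IH]; first by rewrite !expr0 mul1r mulr1.
by rewrite exprS -mulrA IH mulrA diskewHC -mulrA.
Qed.

Lemma diskewXnC n d : X ^+ n * C d = C (iter n sigma d) * X ^+ n.
Proof.
elim: n => [|n IH]; first by rewrite !expr0 mul1r mulr1.
by rewrite exprS -mulrA IH mulrA diskewXC -mulrA.
Qed.

Lemma diskewXYE : X * Y = C rho * h + C b.
Proof. by apply/eqP; rewrite addrC -subr_eq diskewXY. Qed.

Lemma diskewXH : X * h = (C rho * h + C b) * X.
Proof. by rewrite /h mulrA diskewXYE. Qed.

(** As x y = x h x^(-1) = rho h + b formally, this covers both x^n h and
x^(n+1) y. *)
Lemma diskewXn_sigmaH n :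
  X ^+ n * (C rho * h + C b) = (C 'a_n.+1 * h + C (beta n.+1)) * X ^+ n.
Proof.
elim: n => [|n IH].
  by rewrite !expr0 mul1r mulr1 diskew_aS diskew_a0 /= mulr1 mulr0 add0r.
have XH : X ^+ n.+1 * h = (C 'a_n.+1 * h + C (beta n.+1)) * X ^+ n.+1.
  by rewrite exprSr -mulrA diskewXH mulrA IH -mulrA.
rewrite mulrDr mulrA !diskewXnC -[C _ * _ * h]mulrA XH.
have -> : beta n.+2 = iter n.+1 sigma rho * beta n.+1 + iter n.+1 sigma b by [].
rewrite (diskew_aS _ _ n.+1); move: (beta n.+1) 'a_n.+1 => B A.
by rewrite rmorphD !rmorphM mulrA -mulrDl mulrDr !mulrA -!addrA.
Qed.

Lemma diskewXnH n : X ^+ n * h = (C 'a_n * h + C (beta n)) * X ^+ n.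
Proof.
case: n => [|n].
  by rewrite !expr0 diskew_a0 /= rmorph0 rmorph1 addr0 !mul1r mulr1.
by rewrite exprSr -mulrA diskewXH mulrA diskewXn_sigmaH -mulrA.
Qed.

Lemma diskewXnY n : X ^+ n.+1 * Y = (C 'a_n.+1 * h + C (beta n.+1)) * X ^+ n.
Proof. by rewrite exprSr -mulrA diskewXYE diskewXn_sigmaH. Qed.

Definition ev (p : {poly D}) : E := \sum_(k < size p) C p`_k * h ^+ k.

Lemma evE n (p : {poly D}) : (size p <= n)%N ->
  ev p = \sum_(k < n) C p`_k * h ^+ k.
Proof.
move=> pn; rewrite /ev (big_ord_widen _ (fun k => C p`_k * h ^+ k) pn).
rewrite big_mkcond; apply: eq_bigr => i _; case: ltnP => // /leq_sizeP.
by move=> /(_ i (leqnn i)) ->; rewrite rmorph0 mul0r.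
Qed.

Lemma evB p q : ev (p - q) = ev p - ev q.
Proof.
pose n := maxn (size p) (size q).
have sp : (size p <= n)%N by rewrite leq_maxl.
have sq : (size q <= n)%N by rewrite leq_maxr.
have spq : (size (p - q)%R <= n)%N.
  by rewrite (leq_trans (size_polyD _ _)) // size_polyN.
rewrite (evE sp) (evE sq) (evE spq) -sumrB; apply: eq_bigr => i _.
by rewrite coefB rmorphB mulrBl.
Qed.

HB.instance Definition _ := GRing.isZmodMorphism.Build {poly D} E ev evB.

Lemma evZ d p : ev (d *: p) = C d * ev p.
Proof.
rewrite (evE (size_scale_leq _ _)) mulr_sumr; apply: eq_bigr => i _.
by rewrite coefZ rmorphM mulrA.
Qed.

Lemma ev_twist p d : ev (twist p d) = ev p * C d.
Proof.
rewrite (evE (size_twist _ _ _ _)) mulr_suml; apply: eq_bigr => i _.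
by rewrite coef_twist rmorphM -mulrA -diskewHnC mulrA.
Qed.

Lemma evMX p : ev (p * 'X) = ev p * h.
Proof.
have s : (size (p * 'X)%R <= (size p).+1)%N.
  by apply/leq_sizeP => -[|j] // pj; rewrite coefMX /= nth_default.
rewrite (evE s) big_ord_recl coefMX /= rmorph0 mul0r add0r mulr_suml.
apply: eq_bigr => i _; rewrite coefMX /= -mulrA; congr (_ * _).
by rewrite -exprSr.
Qed.

Lemma ev_hmul p : ev (hmul p) = h * ev p.
Proof.
have s : (size (map_poly nu p) <= size p)%N by exact: size_poly.
rewrite /hmul evMX (evE s) mulr_suml mulr_sumr; apply: eq_bigr => i _.
by rewrite coef_map -mulrA -exprSr mulrA diskewHC -mulrA -exprS.
Qed.

Lemma ev1 : ev 1 = 1.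
Proof.
have s : (size (1%R : {poly D}) <= 1)%N by rewrite size_poly1.
by rewrite (evE s) big_ord1 coef1 expr0 mulr1 rmorph1.
Qed.

Lemma ev_sigma_pow k : X * h ^+ k = ev (sigma_pow k) * X.
Proof.
elim: k => [|k IH]; first by rewrite expr0 mulr1 ev1 mul1r.
rewrite exprS mulrA diskewXH -mulrA IH mulrA; congr (_ * _).
by rewrite /= raddfD /= !evZ ev_hmul mulrDl mulrA.
Qed.

Lemma ev_sigma_ext p : X * ev p = ev (sigma_ext p) * X.
Proof.
rewrite /sigma_ext raddf_sum mulr_sumr mulr_suml; apply: eq_bigr => i _.
by rewrite /= evZ mulrA diskewXC -mulrA ev_sigma_pow mulrA.
Qed.

Definition evX N (P : nat -> {poly D}) : E := \sum_(n < N) ev (P n) * X ^+ n.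

Lemma evX_B N P Q : evX N P - evX N Q = evX N (fun n => P n - Q n).
Proof.
by rewrite /evX -sumrB; apply: eq_bigr => i _; rewrite raddfB mulrBl.
Qed.

Lemma evX_D N P Q : evX N P + evX N Q = evX N (fun n => P n + Q n).
Proof.
by rewrite /evX -big_split; apply: eq_bigr => i _; rewrite raddfD mulrDl.
Qed.

Lemma evX_Z N d P : C d * evX N P = evX N (fun n => d *: P n).
Proof.
by rewrite /evX mulr_sumr; apply: eq_bigr => i _; rewrite evZ mulrA.
Qed.

Lemma evX_C N d P :
  evX N P * C d = evX N (fun n => twist (P n) (iter n sigma d)).
Proof.
rewrite /evX mulr_suml; apply: eq_bigr => i _.
by rewrite -mulrA diskewXnC mulrA -ev_twist.
Qed.

Lemma evX_hmul N P : h * evX N P = evX N (fun n => hmul (P n)).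
Proof.
by rewrite /evX mulr_sumr; apply: eq_bigr => i _; rewrite ev_hmul mulrA.
Qed.

Lemma evX_X N P : X * evX N P = evX N (fun n => sigma_ext (P n)) * X.
Proof.
rewrite /evX mulr_sumr mulr_suml; apply: eq_bigr => i _.
by rewrite mulrA ev_sigma_ext -!mulrA -exprSr -exprS.
Qed.

(** The product p (c h + d) in D[h; nu]. *)
Definition linmul (p : {poly D}) (c d : D) := twist p c * 'X + twist p d.

Lemma ev_linmul p c d : ev (linmul p c d) = ev p * (C c * h + C d).
Proof. by rewrite /linmul raddfD /= evMX !ev_twist mulrDr !mulrA. Qed.

Lemma evX_H N P :
  evX N P * h = evX N (fun n => linmul (P n) 'a_n (beta n)).
Proof.
rewrite /evX mulr_suml; apply: eq_bigr => i _.
by rewrite -mulrA diskewXnH mulrA ev_linmul.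
Qed.

Lemma evX_shift N P : evX N.+1 P = ev (P 0%N) + evX N (fun n => P n.+1) * X.
Proof.
rewrite /evX big_ord_recl expr0 mulr1 mulr_suml; congr (_ + _).
by apply: eq_bigr => i _; rewrite -mulrA -exprSr.
Qed.

Lemma evX_recr N P : evX N.+1 P = evX N P + ev (P N) * X ^+ N.
Proof. by rewrite /evX big_ord_recr. Qed.

Lemma linmul_unit_eq0 p c d : is_unit c -> linmul p c d = 0 -> p = 0.
Proof.
move=> uc pcd; apply/eqP; apply: contraT => nzp; case/negP: (nzp).
have := congr1 (fun q : {poly D} => q`_(size p).-1.+1) pcd.
rewrite coefD coefMX !coef_twist coef0 /=.
rewrite [p`__.+1]nth_default ?mul0r ?addr0; last first.
  by rewrite prednK // size_poly_gt0.
move/is_unit_mulr0 => /(_ _); rewrite -lead_coefE.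
move=> lp0; rewrite -lead_coef_eq0; apply/eqP/lp0.
elim: _.-1 => //= k IH; exact: (is_unit_iter tau 1 (is_unit_iter sigma 1 IH)).
Qed.

(** * Inverting x: saturation of an ideal *)

Section Saturation.
Hypothesis rho_u : is_unit rho.
Hypothesis sigma_surj : forall d, exists c, sigma c = d.
Hypothesis beta_u : forall n, is_unit (beta n.+1).
Variable I : set E.
Hypothesis idI : two_sided_ideal I.

Definition saturation : set E := fun u => exists n, I (u * X ^+ n).

Lemma diskewC_swapXn n d : exists c, C d * X ^+ n = X ^+ n * C c.
Proof.
by have [c <-] := iter_surj n sigma_surj d; exists c; rewrite diskewXnC.
Qed.

(** The extension of sigma to polynomials in h is surjective:
h = sigma(c h + d) for sigma(c) = rho^(-1) and sigma(d) = - rho^(-1) b. *)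
Lemma diskewH_swapXn n : exists u, h * X ^+ n = X ^+ n * u.
Proof.
have [r [r_rho _]] := rho_u.
have [c cr] := sigma_surj r; have [d db] := sigma_surj (- (r * b)).
have hX : h * X = X * (C c * h + C d).
  rewrite mulrDr mulrA !diskewXC -mulrA diskewXH cr db mulrA -mulrDl.
  by rewrite mulrDr mulrA -!rmorphM r_rho rmorph1 mul1r rmorphN addrK.
elim: n => [|n [u IH]]; first by exists h; rewrite expr0 mulr1 mul1r.
have [e eE] := diskewC_swapXn n c; have [f fE] := diskewC_swapXn n d.
exists (C e * u + C f).
rewrite exprS mulrA hX -mulrA mulrDl -mulrA IH mulrA eE fE.
by rewrite -[_ * C e * u]mulrA -mulrDr mulrA.
Qed.

(** For right multiplication by y, note that y x^(n+1) = h x^n = x^n v for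
some v. *)
Lemma saturation_ideal : two_sided_ideal saturation.
Proof.
have [I0 IB IM] := idI.
have IMr u r : I u -> I (u * r) by move=> /(IM r) [].
have IMl u r : I u -> I (r * u) by move=> /(IM r) [].
have satB u v : saturation u -> saturation v -> saturation (u - v).
  move=> [n Iu] [m Iv]; exists (n + m)%N; rewrite mulrBl; apply: IB.
    by rewrite exprD mulrA; exact: IMr.
  by rewrite addnC exprD mulrA; exact: IMr.
have sat0 : saturation 0 by exists 0%N; rewrite mul0r.
split=> // r u su; split.
  by case: su => n Iu; exists n; rewrite -mulrA; exact: IMl.
move: u su; elim/diskew_ind: r => [d|||r s IHr IHs|r IHr|r s IHr IHs] u su.
- case: su => n Iu; exists n; have [c cE] := diskewC_swapXn n d.
  by rewrite -mulrA cE mulrA; exact: IMr.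
- by case: su => n Iu; exists n; rewrite -mulrA -exprS exprSr mulrA; exact: IMr.
- case: su => n Iu; exists n.+1; have [v vE] := diskewH_swapXn n.
  by rewrite exprS -mulrA [Y * _]mulrA vE mulrA; exact: IMr.
- rewrite mulrDr -[u * s]opprK; apply: (satB); first exact: IHr.
  by rewrite -sub0r; apply: satB => //; exact: IHs.
- by rewrite mulrN -sub0r; apply: satB => //; exact: IHr.
- by rewrite mulrA; apply: IHs; exact: IHr.
Qed.

Lemma saturation_sub u : I u -> saturation u.
Proof. by exists 0%N; rewrite mulr1. Qed.

Lemma saturation_cancel u : saturation (u * X) -> saturation u.
Proof. by move=> [n Iu]; exists n.+1; rewrite exprS mulrA. Qed.

(** If x^(n+1) is in I, then so is b_(n+1) x^n, by subtracting
a_(n+1) y x^(n+1) from x^(n+1) y. *)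
Lemma saturation_proper : ~ I 1 -> ~ saturation 1.
Proof.
have [I0 IB IM] := idI.
move=> nI [n]; rewrite mul1r; elim: n => // n IH IXn; apply: IH.
have [v [vb _]] := beta_u n.
have -> : X ^+ n = C v * (X ^+ n.+1 * Y - C 'a_n.+1 * Y * X ^+ n.+1).
  rewrite diskewXnY mulrDl exprS /h -!mulrA [X in X - _]addrC addrK mulrA.
  by rewrite -rmorphM vb rmorph1 mul1r.
have [_ IXY] := IM Y _ IXn; have [IYX _] := IM (C 'a_n.+1 * Y) _ IXn.
by have [] := IM (C v) _ (IB _ _ IXY IYX).
Qed.

End Saturation.

End Evaluation.

(** * Sufficiency: independence and spanning of monomials *)

Section Simplicity.
Variables (D : algType rat) (sigma tau : {rmorphism D -> D}) (b rho : D).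
Local Notation nu := (tau \o sigma).
Local Notation E := (diskew sigma tau b rho).
Local Notation C := (diskewC sigma tau b rho).
Local Notation X := (diskewX sigma tau b rho).
Local Notation Y := (diskewY sigma tau b rho).
Local Notation h := (diskewH sigma tau b rho).
Local Notation twist := (twist sigma tau).
Local Notation hmul := (hmul sigma tau).
Local Notation linmul := (linmul sigma tau).
Local Notation sigma_ext := (sigma_ext sigma tau b rho).
Local Notation "'a_ n" := (diskew_a sigma rho n)
  (at level 8, n at level 2, format "''a_' n").
Local Notation beta := (diskew_beta sigma b rho).
Local Notation ev := (@ev D sigma tau b rho).
Local Notation evX := (@evX D sigma tau b rho).
Hypothesis b_rho : b * rho = rho * nu b.
Hypothesis rho_u : is_unit rho.
Hypothesis nu_surj : forall d, exists c, nu c = d.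
Hypothesis sigma_surj : forall d, exists c, sigma c = d.
Hypothesis beta_u : forall n, is_unit (beta n.+1).
Hypothesis simD : sigma_simple sigma.
Hypothesis no_alpha : ~ exists alpha, rho * alpha - sigma alpha = b /\
      forall d, alpha * d = nu d * alpha.

Section Independence.
Variable I : set E.
Hypothesis idI : two_sided_ideal I.
Hypothesis nI1 : ~ I 1.
Hypothesis cancelX : forall u, I (u * X) -> I u.

(** The equation is p h = (a h + b_(N+1)) p; its coefficient of h^k expresses
b_(N+1) p_k through p_(k-1). *)
Lemma commute_H_eq0 N (p : {poly D}) :
  p * 'X - ('a_N.+1 *: hmul p + beta N.+1 *: p) = 0 -> p = 0.
Proof.
move=> e; apply/polyP => k; rewrite coef0.
have ek j := congr1 (fun q : {poly D} => q`_j) e.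
elim: k => [|k IH].
  have := ek 0%N; rewrite coefB coefMX coefD !coefZ coef_hmul coef0 /= mulr0.
  rewrite sub0r add0r => /eqP; rewrite oppr_eq0 => /eqP.
  exact: (is_unit_mull0 (beta_u N)).
have := ek k.+1; rewrite coefB coefMX coefD !coefZ coef_hmul coef0 /= IH.
rewrite !rmorph0 mulr0 sub0r add0r => /eqP; rewrite oppr_eq0 => /eqP.
exact: (is_unit_mull0 (beta_u N)).
Qed.

(** Induction on the length N.  The leading coefficients of the sums of length
N + 1 in I form a set J as in [stable_family1]; stability under sigma
uses that x can be cancelled on the right.  So a nonzero leading coefficient
may be replaced by 1. *)
Lemma evX_independent N P : I (evX N P) -> forall n, (n < N)%N -> P n = 0.
Proof.
have [I0 IB IM] := idI.
have IMr u r : I u -> I (u * r) by move=> /(IM r) [].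
have IMl u r : I u -> I (r * u) by move=> /(IM r) [].
elim: N P => [//|N IH] P IP.
have lead_eq0 : P N = 0.
  apply/eqP; apply: contraT => nz.
  pose J q := exists Q, I (evX N Q + ev q * X ^+ N).
  have J1 : J 1.
    apply: (stable_family1 (sigma := sigma) (tau := tau) (rho := rho) (p := P N)
      b_rho rho_u nu_surj simD no_alpha _ _ _ _ _ nz).
    - move=> q r [Q IQ] [R IR]; exists (fun n => Q n - R n).
      rewrite -evX_B raddfB mulrBl addrACA -opprD; exact: IB.
    - move=> d q [Q IQ]; exists (fun n => d *: Q n).
      by rewrite evZ -evX_Z -mulrA -mulrDr; exact: IMl.
    - move=> d q [Q IQ]; have [c <-] := iter_surj N sigma_surj d.
      exists (fun n => twist (Q n) (iter n sigma c)).
      rewrite -evX_C ev_twist -mulrA -diskewXnC mulrA -mulrDl.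
      exact: IMr.
    - move=> q [Q IQ]; exists (fun n => sigma_ext (Q n)); apply: cancelX.
      rewrite mulrDl -evX_X -mulrA -exprSr exprS mulrA -ev_sigma_ext.
      by rewrite -mulrA -mulrDr; exact: IMl.
    - by exists P; rewrite -evX_recr.
  case: J1 => Q; rewrite ev1 mul1r.
  case: N IH {P IP nz J} => [|N] IH IQ.
    by case: nI1; move: IQ; rewrite /evX big_ord0 add0r expr0.
  (* With u = x^(N+1) + ..., the element u h - (a_(N+1) h + b_(N+1)) u of I has
     length N + 1, so its constant term vanishes by induction. *)
  have Q0 : Q 0%N = 0.
    apply: (@commute_H_eq0 N).
    pose R n := linmul (Q n) 'a_n (beta n)
       - ('a_N.+1 *: hmul (Q n) + beta N.+1 *: Q n).
    have : R 0%N = 0.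
      apply: (IH R) => //.
      have -> : evX N.+1 R = (evX N.+1 Q + X ^+ N.+1) * h
        - (C 'a_N.+1 * h + C (beta N.+1)) * (evX N.+1 Q + X ^+ N.+1).
        rewrite mulrDl diskewXnH mulrDr opprD addrACA subrr addr0.
        by rewrite evX_H mulrDl -mulrA evX_hmul !evX_Z evX_D evX_B.
      by apply: IB; [exact: IMr|exact: IMl].
    rewrite /R /linmul diskew_a0 /= => <-; congr (_ - _).
    apply/polyP => k; rewrite coefD !coefMX !coef_twist.
    by rewrite iter_rmorph0 mulr0 addr0 iter_rmorph1 mulr1.
  (* Now u is a right multiple of x; cancelling x leaves a sum of length N + 1
     with leading coefficient 1. *)
  have : I (evX N.+1 (fun n => if n == N then 1 else Q n.+1)).
    apply: cancelX; move: IQ; rewrite evX_shift Q0 raddf0 add0r exprSr -mulrDl.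
    rewrite evX_recr eqxx ev1 mul1r; congr (I ((_ + _) * _)).
    by apply: eq_bigr => i _; rewrite ltn_eqF.
  by move/IH => /(_ N (leqnn _)) /eqP; rewrite eqxx oner_eq0.
move=> n; rewrite ltnS leq_eqVlt => /predU1P[->//|]; apply: IH.
by move: IP; rewrite evX_recr lead_eq0 raddf0 mul0r addr0.
Qed.

End Independence.

Lemma evX_widen K L P : (K <= L)%N -> exists Q, evX K P = evX L Q.
Proof.
move=> KL; exists (fun n => if (n < K)%N then P n else 0).
rewrite /evX (big_ord_widen _ (fun n => ev (P n) * X ^+ n) KL) big_mkcond.
by apply: eq_bigr => i _; case: ifP; rewrite // raddf0 mul0r.
Qed.

(** The span of the p(h) x^n, for all n, and of the p(h) y^n, for
1 <= n <= M.  The recursion on M is that of [proper_ideal_eq0], which removes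
the highest power of y first. *)
Fixpoint evYX M (u : E) : Prop :=
  if M is m.+1 then exists p v, evYX m v /\ u = ev p * Y ^+ m.+1 + v
  else exists K P, u = evX K P.

Lemma evYX_S M u : evYX M u -> evYX M.+1 u.
Proof. by exists 0, u; rewrite raddf0 mul0r add0r. Qed.

Lemma evYX_D M u v : evYX M u -> evYX M v -> evYX M (u + v).
Proof.
elim: M u v => [|M IH] u v /=.
  move=> [K [P ->]] [L [Q ->]].
  have [P' ->] := evX_widen P (leq_maxl K L).
  have [Q' ->] := evX_widen Q (leq_maxr K L).
  by rewrite evX_D; exists (maxn K L), (fun n => P' n + Q' n).
move=> [p [u' [hu ->]]] [q [v' [hv ->]]]; exists (p + q), (u' + v').
by split; [exact: IH|rewrite raddfD mulrDl addrACA].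
Qed.

Lemma evYX_C M d u : evYX M u -> evYX M (C d * u).
Proof.
elim: M u => [|M IH] u /=.
  by move=> [K [P ->]]; exists K, (fun n => d *: P n); rewrite evX_Z.
move=> [p [v [hv ->]]]; exists (d *: p), (C d * v).
by split; [exact: IH|rewrite evZ mulrDr mulrA].
Qed.

Lemma evYX_monX p n : evYX 0 (ev p * X ^+ n).
Proof.
exists n.+1, (fun i => if i == n then p else 0).
rewrite evX_recr eqxx [evX _ _]big1 ?add0r // => i _.
by rewrite ltn_eqF // raddf0 mul0r.
Qed.

Lemma evYX_monY p n : evYX n (ev p * Y ^+ n).
Proof.
case: n => [|n]; first exact: evYX_monX p 0%N.
exists p, 0; rewrite addr0; split=> //.
elim: n => [|n IH]; first by exists 0%N, (fun=> 0); rewrite /evX big_ord0.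
exact: evYX_S.
Qed.

Lemma evYX_X M u : evYX M u -> evYX M (X * u).
Proof.
elim: M u => [|M IH] u.
  move=> [K [P ->]]; exists K.+1.
  exists (fun n => if n is m.+1 then sigma_ext (P m) else 0).
  by rewrite evX_shift raddf0 add0r evX_X.
move=> [p [v [hv ->]]]; rewrite mulrDr; apply: evYX_D; last exact/evYX_S/IH.
rewrite mulrA ev_sigma_ext -mulrA exprS [X * _]mulrA diskewXYE mulrA -ev_linmul.
exact/evYX_S/evYX_monY.
Qed.

(** Solve h y = y (rho h + b) = tau(rho) y h + tau(b) y for y h. *)
Lemma diskewYH : exists l m, is_unit l /\ Y * h = (C l * h + C m) * Y.
Proof.
have [v [vr rv]] := rho_u.
exists (tau v), (- (tau v * tau b)); split.
  by exists (tau rho); rewrite -!rmorphM vr rv rmorph1.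
have hY : h * Y = C (tau rho) * (Y * h) + C (tau b) * Y.
  by rewrite -mulrA diskewXYE mulrDr mulrA !diskewYC mulrA.
rewrite rmorphN mulrBl -mulrA hY mulrDr !mulrA -!rmorphM vr rmorph1.
by rewrite rmorph1 mul1r -!mulrA addrK.
Qed.

Lemma diskewY_ev p : exists q, Y * ev p = ev q * Y.
Proof.
have [l [m [_ YH]]] := diskewYH.
have Yh k : exists q, Y * h ^+ k = ev q * Y.
  elim: k => [|k [q IH]]; first by exists 1; rewrite expr0 mulr1 ev1 mul1r.
  exists (l *: hmul q + m *: q).
  rewrite exprS mulrA YH -mulrA IH mulrA; congr (_ * _).
  by rewrite raddfD /= !evZ ev_hmul mulrDl mulrA.
rewrite [in Y * _]/ev.
elim/big_ind: _ => [|u v [q hq] [r hr]|k _].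
- by exists 0; rewrite raddf0 mulr0 mul0r.
- by exists (q + r); rewrite mulrDr hq hr raddfD mulrDl.
- have [q hq] := Yh k; exists (tau p`_k *: q).
  by rewrite mulrA diskewYC -mulrA hq evZ mulrA.
Qed.

Lemma evYX_Y M u : evYX M u -> evYX M.+1 (Y * u).
Proof.
elim: M u => [|M IH] u.
  move=> [K [P ->]]; rewrite /evX mulr_sumr.
  elim/big_ind: _ => [|v w|n _].
  - by rewrite -[0](mul0r (Y ^+ 1)) -(raddf0 ev); exact: evYX_monY.
  - exact: evYX_D.
  - rewrite mulrA; have [q ->] := diskewY_ev (P n).
    case: (n : nat) => [|k]; first by rewrite mulr1; exact: evYX_monY q 1%N.
    rewrite exprS -mulrA [Y * _]mulrA -/h mulrA -evMX.
    exact/evYX_S/evYX_monX.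
move=> [p [v [hv ->]]]; rewrite mulrDr; apply: evYX_D; last exact/evYX_S/IH.
have [q qE] := diskewY_ev p.
by rewrite mulrA qE -mulrA -exprS; exact: evYX_monY.
Qed.

Lemma evYX_full u : exists M, evYX M u.
Proof.
have mono M N v : (M <= N)%N -> evYX M v -> evYX N v.
  move=> /subnK <-; elim: (N - M)%N => // k IH hv.
  by rewrite addSn; apply: evYX_S; exact: IH.
have step r v : (exists M, evYX M v) -> exists M, evYX M (r * v).
  elim/diskew_ind: r v => [d|||r s IHr IHs|r IHr|r s IHr IHs] v hv.
  - by case: hv => M hv; exists M; exact: evYX_C.
  - by case: hv => M hv; exists M; exact: evYX_X.
  - by case: hv => M hv; exists M.+1; exact: evYX_Y.
  - have [M hr] := IHr v hv; have [N hs] := IHs v hv.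
    exists (maxn M N); rewrite mulrDl; apply: evYX_D.
      exact: mono (leq_maxl _ _) hr.
    exact: mono (leq_maxr _ _) hs.
  - have [M hr] := IHr v hv; exists M.
    by rewrite mulNr -mulN1r -(rmorph1 C) -rmorphN; exact: evYX_C.
  - by rewrite -mulrA; apply: IHr; exact: IHs.
rewrite -[u]mulr1; apply: step; exists 0%N.
by rewrite -[1]mulr1 -{1}ev1; exact: evYX_monX 1 0%N.
Qed.

Lemma diskewYnH n :
  exists l m, is_unit l /\ Y ^+ n * h = (C l * h + C m) * Y ^+ n.
Proof.
elim: n => [|n [l [m [lu IH]]]].
  exists 1, 0; rewrite rmorph0 rmorph1 expr0 addr0 !mul1r mulr1.
  by split=> //; exact: is_unit1.
have [l1 [m1 [l1u YH]]] := diskewYH.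
exists (tau l * l1), (tau l * m1 + tau m); split.
  by apply: is_unit_mul => //; exact: (is_unit_iter tau 1 lu).
rewrite exprS -mulrA IH mulrA mulrDr mulrA !diskewYC -mulrA YH mulrA -mulrDl.
rewrite -mulrA; congr (_ * _).
by rewrite mulrDr mulrA [C (_ + _)]rmorphD addrA /= !rmorphM.
Qed.

(** y^n x^n is a product of n factors l h + m with l a unit, so multiplication
by it is injective on polynomials in h. *)
Lemma ev_YnXn p n :
  exists q, ev p * (Y ^+ n * X ^+ n) = ev q /\ (q = 0 -> p = 0).
Proof.
elim: n p => [|n IH] p; first by exists p; rewrite !mulr1.
have [l [m [lu YH]]] := diskewYnH n.
have [q [qE q0]] := IH (linmul p l m).
exists q; split; last by move/q0; exact: linmul_unit_eq0.
rewrite -qE ev_linmul exprSr exprS !mulrA -[_ * Y * X]mulrA -/h.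
by rewrite -[_ * _ * h]mulrA YH !mulrA.
Qed.

Lemma evYX_mulXn M u : evYX M u -> exists K P, u * X ^+ M = evX K P.
Proof.
elim: M u => [|M IH] u; first by rewrite mulr1.
move=> [p [v [/IH [K [P vE]] ->]]].
have [q [qE _]] := ev_YnXn p M.+1.
exists K.+1, (fun n => if n is k.+1 then P k else q).
by rewrite evX_shift -vE -mulrA -exprSr mulrDl -mulrA qE.
Qed.

(** For u in the saturation, with powers of y up to M + 1, the constant term of
u x^(M+1) is p y^(M+1) x^(M+1), where p is the coefficient of y^(M+1) in u; all
other terms of u contribute to positive powers of x. *)
Lemma proper_ideal_eq0 (I : set E) :
  two_sided_ideal I -> ~ I 1 -> forall u, I u -> u = 0.
Proof.
move=> idI nI1 u Iu.
pose I' := saturation I.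
have idI' : two_sided_ideal I' := saturation_ideal rho_u sigma_surj idI.
have indep := evX_independent idI' (saturation_proper beta_u idI nI1)
  (@saturation_cancel _ _ _ _ _ I).
have {Iu} : I' u by exact: saturation_sub.
have [M] := evYX_full u.
elim: M u => [|M IH] u.
  move=> [K [P ->]] /indep P0.
  by rewrite [evX _ _]big1 // => i _; rewrite P0 // raddf0 mul0r.
move=> [p [v [hv ->]]] I'u.
have [q [qE q0]] := ev_YnXn p M.+1.
have [K [P vE]] := evYX_mulXn hv.
have p0 : p = 0.
  apply/q0/(indep K.+1 (fun n => if n is k.+1 then P k else q) _ 0%N) => //.
  rewrite evX_shift -vE -mulrA -exprSr -qE mulrA -mulrDl.
  by case: idI' => _ _ /(_ (X ^+ M.+1) _ I'u) [].
by move: I'u; rewrite p0 raddf0 mul0r add0r; exact: IH.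
Qed.

End Simplicity.

Theorem theorem1p4
    (D : algType rat) (sigma tau : {rmorphism D -> D}) (b rho : D)
    (Hrho : forall d : D, sigma (tau d) * rho = rho * tau (sigma d))
    (Hb : forall d : D, sigma (tau d) * b = b * d)
    (rho_unit : is_unit rho)
    (nu_surj : forall d : D, exists d' : D, tau (sigma d') = d) :
  simple_ring (diskew sigma tau b rho)
  <->
  [/\ bijective sigma /\ bijective tau,
      sigma_simple sigma,
      ~ (exists alpha : D,
           rho * alpha - sigma alpha = b /\
           forall d : D, alpha * d = tau (sigma d) * alpha)
    & forall i : nat, (1 <= i)%N -> is_unit (diskew_b sigma b rho i)].
Proof.
have tau_surj d : exists c, tau c = d.
  by have [c cd] := nu_surj d; exists (sigma c).
have sigma_surj d : exists c, sigma c = d.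
  have [v [vr rv]] := rho_unit.
  have [c cd] := nu_surj (v * d * rho); exists (tau c).
  by apply: (is_unit_mulrI rho_unit); rewrite Hrho cd !mulrA rv mul1r.
split=> [simE|[_ simD no_alpha b_u]].
  have b_u := simple_b_unit Hrho Hb simE sigma_surj tau_surj.
  have bu : is_unit b by have := b_u 0%N; rewrite /= mulr0 add0r.
  (* sigma tau (d) b = b d with b a unit *)
  have st0 d : sigma (tau d) = 0 -> d = 0.
    by move=> d0; apply: (is_unit_mull0 bu); rewrite -Hb d0 mul0r.
  have bij (f : {rmorphism D -> D}) : (forall d, exists c, f c = d) ->
      (forall d, f d = 0 -> d = 0) -> bijective f.
    move=> f_surj f0; have [g fK] := choice f_surj.
    by exists g => // d; apply/subr0_eq/f0; rewrite rmorphB fK subrr.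
  split.
  - split; apply: bij => // d d0; last by apply: st0; rewrite d0 rmorph0.
    apply: st0; apply: (is_unit_mulr0 rho_unit).
    by rewrite Hrho d0 rmorph0 mulr0.
  - exact: simple_sigma_simple simE.
  - exact: simple_no_alpha simE _ _.
  - by case=> // i _; rewrite -diskew_betaE.
have beta_u n : is_unit (diskew_beta sigma b rho n.+1).
  by rewrite diskew_betaE; exact: b_u.
have bu : is_unit b by have := beta_u 0%N; rewrite /= mulr0 add0r.
have b_rho : b * rho = rho * (tau \o sigma) b.
  have sb : sigma (tau b) = b by apply: (is_unit_mulrI bu); exact: Hb.
  by rewrite -{1}sb Hrho.
split=> [|I idI].
  by apply: (diskew_nontrivial Hrho Hb); apply/eqP; exact: oner_neq0.
have [I1|nI1] := pselect (I 1).
  right; apply/seteqP; split=> // u _.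
  by have [_ _ /(_ u 1 I1) []] := idI; rewrite mulr1.
left; apply/seteqP; split=> [u|u ->]; last by case: idI.
exact: (proper_ideal_eq0 b_rho rho_unit nu_surj sigma_surj beta_u simD
  no_alpha).
Qed.
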